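(* Let $V^1, V^2, V^3$ be two-dimensional real vector spaces, let $B$ denote a collection of bases $\{e^i_1, e^i_2\}$ of $V^i$ for $i=1,2,3$, and let $\|\cdot\|_{B,2}$ be the Frobenius norm on $V^1\otimes V^2\otimes V^3$ with respect to $B$. If $\tau \in V^1\otimes V^2\otimes V^3$ has rank three, then there does not exist an optimal rank two approximation of $\tau$ with respect to $\|\cdot\|_{B,2}$.
   Context: The rank $\mathrm{rk}(\tau)$ of a tensor $\tau \in V^1\otimes V^2\otimes V^3$ is the minimum $n$ such that $\tau = \sum_{i=1}^n v^1_i\otimes v^2_i\otimes v^3_i$ for some $v^s_i\in V^s$ (the zero tensor, as an empty sum, has rank $0$). Frobenius norm with respect to $B$: if $\tau=\sum_{i,j,k} a_{ijk}\, e^1_i\otimes e^2_j\otimes e^3_k$, then $\|\tau\|_{B,2} = \left(\sum_{i,j,k}|a_{ijk}|^2\right)^{1/2}$. Optimal low-rank approximation: for $\tau\in V^1\otimes V^2\otimes V^3$ and $s\le \mathrm{rk}(\tau)$, an optimal rank $s$ approximation of $\tau$ with respect to a norm $\|\cdot\|$ is a tensor $\upsilon$ with $\mathrm{rk}(\upsilon)\le s$ such that $\|\tau-\upsilon\| = \inf\{\|\tau-\upsilon'\| : \upsilon'\in V^1\otimes V^2\otimes V^3,\ \mathrm{rk}(\upsilon')\le s\}$. *)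

(* Defs.v *)
From HB Require Import structures.
From mathcomp Require Import all_boot all_order all_algebra.
From mathcomp Require Import boolp classical_sets reals.

Set Implicit Arguments.
Unset Strict Implicit.
Unset Printing Implicit Defensive.

Import Order.TTheory GRing.Theory Num.Theory.

Local Open Scope classical_set_scope.
Local Open Scope ring_scope.

Definition trilinear (R : realType) (U1 U2 U3 W : lmodType R)
    (f : U1 -> U2 -> U3 -> W) : Prop :=
  [/\ forall v w, linear (fun u => f u v w),
      forall u w, linear (fun v => f u v w)
    & forall u v, linear (fun w => f u v w)].

(* The tensor product is given by its universal property: [ot] is a trilinear
   map into [T], [ot u v w] being the pure tensor of u, v and w, through which
   every trilinear map factors uniquely as a linear map. *)
Definition is_tensor_product (R : realType) (U1 U2 U3 T : lmodType R)
    (ot : U1 -> U2 -> U3 -> T) : Prop :=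
  trilinear ot /\
  forall (W : lmodType R) (f : U1 -> U2 -> U3 -> W), trilinear f ->
    (exists g : {linear T -> W}, forall u v w, g (ot u v w) = f u v w) /\
    (forall g h : {linear T -> W},
       (forall u v w, g (ot u v w) = f u v w) ->
       (forall u v w, h (ot u v w) = f u v w) -> g =1 h).

Section Tensors.
Variables (R : realType) (V1 V2 V3 : vectType R) (T : lmodType R).
Variable ot : V1 -> V2 -> V3 -> T.

Definition sum_of_pure (tau : T) (n : nat) : Prop :=
  exists (v1 : 'I_n -> V1) (v2 : 'I_n -> V2) (v3 : 'I_n -> V3),
    tau = \sum_(i < n) ot (v1 i) (v2 i) (v3 i).

(* The default value 0 is only reached by a tensor which is not a sum of pure
   tensors; there is none when [is_tensor_product ot] (lemma [rkP]). *)
Definition rk (tau : T) : nat :=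
  xget 0%N [set n | sum_of_pure tau n /\
                    forall m, sum_of_pure tau m -> (n <= m)%N].

Variables (n1 n2 n3 : nat).
Variables (e1 : n1.-tuple V1) (e2 : n2.-tuple V2) (e3 : n3.-tuple V3).

Definition tensor_of_coords (a : {ffun 'I_n1 * 'I_n2 * 'I_n3 -> R}) : T :=
  \sum_(i < n1) \sum_(j < n2) \sum_(k < n3)
     a (i, j, k) *: ot (tnth e1 i) (tnth e2 j) (tnth e3 k).

(* The array a with tau = \sum_(i, j, k) a_ijk e1_i (x) e2_j (x) e3_k; it exists
   and is unique when [is_tensor_product ot] and the e's are bases (lemmas
   [tensor_coordsP] and [tensor_coords_uniq]). *)
Definition tensor_coords (tau : T) : {ffun 'I_n1 * 'I_n2 * 'I_n3 -> R} :=
  xget [ffun=> 0] [set a | tau = tensor_of_coords a].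

Definition frobenius_norm (tau : T) : R :=
  Num.sqrt (\sum_(i < n1) \sum_(j < n2) \sum_(k < n3)
              `|tensor_coords tau (i, j, k)| ^+ 2).

Definition optimal_approx (nrm : T -> R) (s : nat) (tau upsilon : T) : Prop :=
  [/\ (s <= rk tau)%N, (rk upsilon <= s)%N
    & nrm (tau - upsilon) =
      inf [set nrm (tau - upsilon') | upsilon' in
             [set upsilon' | (rk upsilon' <= s)%N]]].

End Tensors.

Section Theory.
Variables (R : realType) (V1 V2 V3 : vectType R).

Section Coords.
Variables (n1 n2 n3 : nat).
Variables (e1 : n1.-tuple V1) (e2 : n2.-tuple V2) (e3 : n3.-tuple V3).

Definition coord_prod (u : V1) (v : V2) (w : V3) :
    {ffun 'I_n1 * 'I_n2 * 'I_n3 -> R^o} :=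
  [ffun p => coord e1 p.1.1 u * coord e2 p.1.2 v * coord e3 p.2 w].

Lemma coord_prod_trilinear : trilinear coord_prod.
Proof.
split=> x y a x1 x2; apply/ffunP => p; rewrite !ffunE linearP /=.
- by rewrite !mulrDl /GRing.scale /= !mulrA.
- by rewrite mulrDr mulrDl /GRing.scale /= mulrCA !mulrA.
- by rewrite mulrDr /GRing.scale /= mulrCA.
Qed.

Variables (T : lmodType R) (ot : V1 -> V2 -> V3 -> T).
Let toc : {ffun 'I_n1 * 'I_n2 * 'I_n3 -> R^o} -> T :=
  tensor_of_coords ot e1 e2 e3.

Lemma tensor_of_coords_linear : linear toc.
Proof.
move=> a x y; rewrite /toc /tensor_of_coords scaler_sumr -big_split /=.
apply: eq_bigr => i _; rewrite scaler_sumr -big_split /=; apply: eq_bigr => j _.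
rewrite scaler_sumr -big_split /=; apply: eq_bigr => k _.
by rewrite !ffunE scalerDl scalerA.
Qed.

Hypotheses (e1P : basis_of fullv e1) (e2P : basis_of fullv e2).
Hypothesis e3P : basis_of fullv e3.

Lemma trilinear_expand u v w : trilinear ot ->
  toc (coord_prod u v w) = ot u v w.
Proof.
move=> [l1 l2 l3].
pose f1 v w : {linear V1 -> T} := HB.pack (fun u => ot u v w)
  (GRing.isLinear.Build _ _ _ _ (fun u => ot u v w) (l1 v w)).
pose f2 u w : {linear V2 -> T} := HB.pack (fun v => ot u v w)
  (GRing.isLinear.Build _ _ _ _ (fun v => ot u v w) (l2 u w)).
pose f3 u v : {linear V3 -> T} := HB.pack (fun w => ot u v w)
  (GRing.isLinear.Build _ _ _ _ (fun w => ot u v w) (l3 u v)).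
have -> : ot u v w = f1 v w u by [].
rewrite [in RHS](coord_basis e1P (memvf u)) linear_sum.
apply: eq_bigr => i _; rewrite linearZ /=.
have -> : ot e1`_i v w = f2 e1`_i w v by [].
rewrite [in RHS](coord_basis e2P (memvf v)) linear_sum scaler_sumr.
apply: eq_bigr => j _; rewrite [f2 _ _ _]linearZ /=.
have -> : ot e1`_i e2`_j w = f3 e1`_i e2`_j w by [].
rewrite [in RHS](coord_basis e3P (memvf w)) linear_sum !scaler_sumr.
apply: eq_bigr => k _; rewrite [f3 _ _ _]linearZ /= !scalerA !ffunE /=.
by rewrite !(tnth_nth 0).
Qed.

Lemma coord_prod_basis i j k :
  coord_prod (tnth e1 i) (tnth e2 j) (tnth e3 k) =
  [ffun p => (p == (i, j, k))%:R].
Proof.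
apply/ffunP => -[[i' j'] k']; rewrite !ffunE /= !(tnth_nth 0) !coord_free.
- rewrite !xpair_eqE (eq_sym i) (eq_sym j) (eq_sym k).
  by case: (i' == i); case: (j' == j); case: (k' == k); rewrite ?mulr0 ?mul0r ?mulr1.
- exact: basis_free e3P.
- exact: basis_free e2P.
- exact: basis_free e1P.
Qed.

Section TensorProduct.
Hypothesis otP : is_tensor_product ot.

Lemma tensor_expand : exists g : {linear T -> {ffun 'I_n1 * 'I_n2 * 'I_n3 -> R^o}},
  cancel g toc /\ cancel toc g.
Proof.
have [ot3 univ] := otP.
have [[g gE] _] := univ _ _ coord_prod_trilinear.
pose L : {linear _ -> T} := HB.pack toc
  (GRing.isLinear.Build _ _ _ _ toc tensor_of_coords_linear).
exists g; split => [x|a].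
  have [_ /(_ (L \o g)%FUN idfun)] := univ _ _ ot3.
  by apply=> // u v w /=; rewrite gE trilinear_expand.
rewrite /toc /tensor_of_coords linear_sum; apply/ffunP => p.
rewrite sum_ffunE.
under eq_bigr => i _ do (rewrite linear_sum sum_ffunE;
  under eq_bigr => j _ do (rewrite linear_sum sum_ffunE;
   under eq_bigr => k _ do rewrite linearZ /= gE coord_prod_basis !ffunE)).
rewrite pair_bigA /= (pair_bigA _ (fun q k => a (q.1, q.2, k) *: (p == (q.1, q.2, k))%:R)) /=.
rewrite (bigD1 p) //= big1 ?addr0.
  by case: p => -[i j] k /=; rewrite eqxx /GRing.scale /= mulr1.
move=> [[i j] k] /= /negPf npq.
by rewrite eq_sym npq scaler0.
Qed.

Lemma tensor_coordsP tau :
  tau = tensor_of_coords ot e1 e2 e3 (tensor_coords ot e1 e2 e3 tau).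
Proof.
have [g [gK _]] := tensor_expand.
rewrite /tensor_coords; case: xgetP => [a _ //|/(_ (g tau))] /=.
by rewrite -[tensor_of_coords _ _ _ _ _]/(toc _) gK.
Qed.

Lemma tensor_coords_uniq a :
  tensor_coords ot e1 e2 e3 (tensor_of_coords ot e1 e2 e3 a) = a.
Proof.
have [g [_ tocK]] := tensor_expand.
by apply: (can_inj tocK); rewrite /toc -tensor_coordsP.
Qed.

Lemma sum_of_pure_exists tau : exists n, sum_of_pure ot tau n.
Proof.
have [[l1 _ _] _] := otP.
have z : exists n, sum_of_pure ot 0 n.
  by exists 0%N, (fun=> 0), (fun=> 0), (fun=> 0); rewrite big_ord0.
have D x y : (exists n, sum_of_pure ot x n) -> (exists n, sum_of_pure ot y n) ->
    exists n, sum_of_pure ot (x + y) n.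
  move=> [m [u1 [u2 [u3 ->]]]] [n [w1 [w2 [w3 ->]]]].
  pose c (U : Type) (f : 'I_m -> U) (g : 'I_n -> U) (i : 'I_(m + n)) :=
    match fintype.split i with inl i => f i | inr i => g i end.
  exists (m + n)%N, (c _ u1 w1), (c _ u2 w2), (c _ u3 w3).
  rewrite big_split_ord /=; congr (_ + _); apply: eq_bigr => i _.
    by rewrite /c (unsplitK (inl i)).
  by rewrite /c (unsplitK (inr i)).
rewrite [tau]tensor_coordsP; apply: (big_ind (fun x => exists n, sum_of_pure ot x n)) => // i _.
apply: (big_ind (fun x => exists n, sum_of_pure ot x n)) => // j _.
apply: (big_ind (fun x => exists n, sum_of_pure ot x n)) => // k _.
set a := tensor_coords _ _ _ _ _ _.
exists 1%N, (fun=> a *: tnth e1 i), (fun=> tnth e2 j), (fun=> tnth e3 k).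
have l1z := GRing.scalable_linear (l1 (tnth e2 j) (tnth e3 k)).
by rewrite big_ord1 l1z.
Qed.

End TensorProduct.

End Coords.

Lemma rkP (T : lmodType R) (ot : V1 -> V2 -> V3 -> T) (tau : T) :
  is_tensor_product ot ->
  sum_of_pure ot tau (rk ot tau) /\
  forall m, sum_of_pure ot tau m -> (rk ot tau <= m)%N.
Proof.
move=> otP; rewrite /rk; case: xgetP => [n _ //|noMin]; exfalso.
have [n nP] := sum_of_pure_exists (vbasisP _) (vbasisP _) (vbasisP _) otP tau.
have ex : exists n, `[< sum_of_pure ot tau n >] by exists n; apply/asboolP.
case: (ex_minnP ex) => m /asboolP mP mmin.
by apply: (noMin m); split=> // k kP; apply: mmin; apply/asboolP.
Qed.

Lemma tensor_product_exists :
  exists (T : lmodType R) (ot : V1 -> V2 -> V3 -> T), is_tensor_product ot.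
Proof.
pose b1 := vbasis (@fullv _ V1); pose b2 := vbasis (@fullv _ V2).
pose b3 := vbasis (@fullv _ V3).
have [p1 p2 p3] : [/\ basis_of fullv b1, basis_of fullv b2 & basis_of fullv b3].
  by split; apply: vbasisP.
exists _, (coord_prod b1 b2 b3); split; first exact: coord_prod_trilinear.
move=> W f f3; split.
  pose toc := (tensor_of_coords f b1 b2 b3).
  pose L : {linear _ -> W} := HB.pack
    (toc : {ffun _ -> R^o} -> W)
    (GRing.isLinear.Build _ _ _ _ _ (tensor_of_coords_linear b1 b2 b3 f)).
  by exists L => u v w; apply: trilinear_expand.
move=> g h gE hE x.
have -> : x = tensor_of_coords (coord_prod b1 b2 b3) b1 b2 b3 x.
  apply/ffunP => p; rewrite /tensor_of_coords sum_ffunE.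
  under eq_bigr => i _ do (rewrite sum_ffunE; under eq_bigr => j _ do
    (rewrite sum_ffunE; under eq_bigr => k _ do
      rewrite ffunE coord_prod_basis // ffunE)).
  rewrite pair_bigA /= (pair_bigA _ (fun q k => x (q.1, q.2, k) *: (p == (q.1, q.2, k))%:R)) /=.
  rewrite (bigD1 p) //= big1 ?addr0.
    by case: p => -[i j] k /=; rewrite eqxx /GRing.scale /= mulr1.
  by move=> [[i j] k] /= /negPf npq; rewrite eq_sym npq scaler0.
rewrite /tensor_of_coords !linear_sum; apply: eq_bigr => i _.
rewrite !linear_sum; apply: eq_bigr => j _; rewrite !linear_sum.
by apply: eq_bigr => k _; rewrite !linearZ /= gE hE.
Qed.

End Theory.

(* Main.v *)
(** The infimum being attained at [upsilon = x (x) y (x) z + x' (x) y' (x) z'],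
    varying one vector at a time shows that the residual [tau - upsilon] is
    orthogonal to [V1 (x) y (x) z], [x (x) V2 (x) z] and [x (x) y (x) V3], and
    likewise for the second summand, whatever the decomposition of [upsilon]
    into two pure tensors. If the three pairs of vectors are bases, this covers
    a basis of the tensor product. If one pair, say [x, x'], is collinear,
    [upsilon] has many decompositions, and those are enough to span as well.
    So the residual vanishes, and [tau = upsilon] has rank at most two. *)
Require Import Defs.
From mathcomp Require Import all_boot all_order all_algebra.
From mathcomp Require Import boolp classical_sets reals.
From mathcomp Require Import ring lra.

Set Implicit Arguments.
Unset Strict Implicit.
Unset Printing Implicit Defensive.

Import Order.TTheory GRing.Theory Num.Theory.

Local Open Scope ring_scope.

(** * Trilinear maps and pairs of vectors in a plane *)

Lemma linear_add (R : pzRingType) (U W : lmodType R) (f : U -> W) :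
  linear f -> {morph f : x y / x + y}.
Proof. by move=> fl x y; rewrite -{1}[x]scale1r fl scale1r. Qed.

Section Trilinear.
Variables (R : realType) (U1 U2 U3 W : lmodType R) (f : U1 -> U2 -> U3 -> W).
Hypothesis f3 : trilinear f.

Lemma trilinearD1 x y v w : f (x + y) v w = f x v w + f y v w.
Proof. by case: f3 => l _ _; apply: (linear_add (l v w)). Qed.

Lemma trilinearD2 x y u w : f u (x + y) w = f u x w + f u y w.
Proof. by case: f3 => _ l _; apply: (linear_add (l u w)). Qed.

Lemma trilinearD3 x y u v : f u v (x + y) = f u v x + f u v y.
Proof. by case: f3 => _ _ l; apply: (linear_add (l u v)). Qed.

Lemma trilinearZ1 a x v w : f (a *: x) v w = a *: f x v w.
Proof. by case: f3 => l _ _; apply: (GRing.scalable_linear (l v w)). Qed.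

Lemma trilinearZ2 a x u w : f u (a *: x) w = a *: f u x w.
Proof. by case: f3 => _ l _; apply: (GRing.scalable_linear (l u w)). Qed.

Lemma trilinearZ3 a x u v : f u v (a *: x) = a *: f u v x.
Proof. by case: f3 => _ _ l; apply: (GRing.scalable_linear (l u v)). Qed.

Lemma trilinear0 v w : f 0 v w = 0.
Proof. by rewrite -(scale0r 0) trilinearZ1 scale0r. Qed.

Lemma trilinear_swap12 : trilinear (fun v u w => f u v w).
Proof. by case: f3. Qed.

Lemma trilinear_swap13 : trilinear (fun w v u => f u v w).
Proof. by case: f3. Qed.

End Trilinear.

(** Proportionality is stated in both directions because either vector may be zero. *)
Lemma collinear_or_span (R : fieldType) (V : vectType R) (x y : V) :
  \dim {: V} = 2%N ->
  [\/ exists c, y = c *: x, exists c, x = c *: y |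
      forall u, exists a b, u = a *: x + b *: y].
Proof.
move=> dimV; have [/vlineP ?|xNy] := boolP (x \in <[y]>%VS); first by constructor 2.
have [y0|yN0] := eqVneq y 0; first by constructor 1; exists 0; rewrite scale0r.
have /andP[/eqP spanE _] : basis_of fullv [:: x; y].
  by rewrite basisEfree free_cons seq1_free span_seq1 xNy yN0 subvf dimV.
constructor 3 => u; have : u \in <<[:: x; y]>>%VS by rewrite spanE memvf.
rewrite span_cons span_seq1 => /memv_addP[_ /vlineP[a ->] [_ /vlineP[b ->] ->]].
by exists a, b.
Qed.

(* The first-order conditions for [t] to be optimal among the tensors of rank at
   most two, when [phi] is the pairing of the residual with pure tensors; those
   for [x', y', z'] follow by swapping the summands. *)
Definition stationary (R : realType) (U1 U2 U3 T W : lmodType R)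
    (ot : U1 -> U2 -> U3 -> T) (phi : U1 -> U2 -> U3 -> W) (t : T) : Prop :=
  forall x y z x' y' z', t = ot x y z + ot x' y' z' ->
  [/\ forall u, phi u y z = 0, forall v, phi x v z = 0 & forall w, phi x y w = 0].

(** * Consequences of the first-order conditions *)

Section Stationary.
Variables (R : realType) (V1 V2 V3 : vectType R) (T W : lmodType R).
Variables (ot : V1 -> V2 -> V3 -> T) (phi : V1 -> V2 -> V3 -> W) (t : T).
Hypotheses (ot3 : trilinear ot) (phi3 : trilinear phi).
Hypothesis phit : stationary ot phi t.

(** Exchanging factors brings a collinear pair in the second or third factor to the first one. *)
Lemma stationary_swap12 :
  stationary (fun v u w => ot u v w) (fun v u w => phi u v w) t.
Proof. by move=> y x z y' x' z' /phit[]. Qed.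

Lemma stationary_swap13 :
  stationary (fun w v u => ot u v w) (fun w v u => phi u v w) t.
Proof. by move=> z y x z' y' x' /phit[]. Qed.

(** Write [t] as [ot 0 v w + ot x y z] with [v] and [w] arbitrary: the condition on the first slot
    of the zero summand is the claim. *)
Lemma stationary_pure x y z : t = ot x y z -> forall u v w, phi u v w = 0.
Proof.
move=> tE u v w; have [//|+ _ _] := phit (x := 0) (y := v) (z := w)
  (x' := x) (y' := y) (z' := z); last exact.
by rewrite trilinear0 // add0r.
Qed.

Hypotheses (dimV2 : \dim {: V2} = 2%N) (dimV3 : \dim {: V3} = 2%N).

(** Here [t] is [x] tensored with a 2 by 2 matrix. If that matrix has rank at most one, [t] is pure;
    otherwise its various decompositions into two rank-one matrices give enough conditions. *)
Lemma stationary_collinear x y z c y' z' :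
  t = ot x y z + ot (c *: x) y' z' -> forall u v w, phi u v w = 0.
Proof.
rewrite trilinearZ1 // -trilinearZ2 //; move: (c *: y') => {c y'} y' tE.
have [[c y'E]|[c yE]|spany] := collinear_or_span y y' dimV2.
- apply: (@stationary_pure x y (z + c *: z')).
  by rewrite tE y'E trilinearD3 // trilinearZ2 // trilinearZ3.
- apply: (@stationary_pure x y' (c *: z + z')).
  by rewrite tE yE trilinearD3 // trilinearZ2 // trilinearZ3.
have [[c z'E]|[c zE]|spanz] := collinear_or_span z z' dimV3.
- apply: (@stationary_pure x (y + c *: y') z).
  by rewrite tE z'E trilinearD2 // trilinearZ2 // trilinearZ3.
- apply: (@stationary_pure x (c *: y + y') z').
  by rewrite tE zE trilinearD2 // trilinearZ2 // trilinearZ3.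
have [yz _ _] := phit tE; have [y'z' _ _] := phit (etrans tE (addrC _ _)).
(* [y (x) z + y' (x) z' = (y + y') (x) z + y' (x) (z' - z)]; similarly below. *)
have y'z u : phi u y' z = 0.
  have tE' : t = ot x (y + y') z + ot x y' (z' - z).
    rewrite tE trilinearD2 // trilinearD3 // -scaleN1r trilinearZ3 // scaleN1r.
    by rewrite addrACA subrr addr0.
  by have [/(_ u) + _ _] := phit tE'; rewrite trilinearD2 // yz add0r.
have yz' u : phi u y z' = 0.
  have tE' : t = ot x y (z + z') + ot x (y' - y) z'.
    rewrite tE trilinearD3 // trilinearD2 // -scaleN1r trilinearZ2 // scaleN1r.
    by rewrite addrACA subrr addr0.
  by have [/(_ u) + _ _] := phit tE'; rewrite trilinearD3 // yz add0r.
(* By linearity in the last two arguments, vanishing on the four pairs from [y, y'] and [z, z']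
   suffices. *)
move=> u v w; have [a [b ->]] := spany v; have [c' [d ->]] := spanz w.
rewrite !(trilinearD2, trilinearD3, trilinearZ2, trilinearZ3) //.
by rewrite yz yz' y'z y'z' !(scaler0, addr0).
Qed.

End Stationary.

Lemma stationary_eq0 (R : realType) (V1 V2 V3 : vectType R) (T W : lmodType R)
    (ot : V1 -> V2 -> V3 -> T) (phi : V1 -> V2 -> V3 -> W) x y z x' y' z' :
  \dim {: V1} = 2%N -> \dim {: V2} = 2%N -> \dim {: V3} = 2%N ->
  trilinear ot -> trilinear phi ->
  stationary ot phi (ot x y z + ot x' y' z') -> forall u v w, phi u v w = 0.
Proof.
set t := ot x y z + _ => d1 d2 d3 ot3 phi3 phit u v w.
have tC : t = ot x' y' z' + ot x y z by rewrite addrC.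
have s12 := stationary_swap12 phit; have s13 := stationary_swap13 phit.
have [[c E]|[c E]|spanx] := collinear_or_span x x' d1.
- apply: (stationary_collinear ot3 phi3 phit d2 d3
    (_ : t = ot x y z + ot (c *: x) y' z')); by rewrite -E.
- apply: (stationary_collinear ot3 phi3 phit d2 d3
    (_ : t = ot x' y' z' + ot (c *: x') y z)); by rewrite -E.
have [[c E]|[c E]|spany] := collinear_or_span y y' d2.
- apply: (stationary_collinear (trilinear_swap12 ot3) (trilinear_swap12 phi3)
    s12 d1 d3 (_ : t = ot x y z + ot x' (c *: y) z')); by rewrite -E.
- apply: (stationary_collinear (trilinear_swap12 ot3) (trilinear_swap12 phi3)
    s12 d1 d3 (_ : t = ot x' y' z' + ot x (c *: y') z)); by rewrite -E.
have [[c E]|[c E]|spanz] := collinear_or_span z z' d3.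
- apply: (stationary_collinear (trilinear_swap13 ot3) (trilinear_swap13 phi3)
    s13 d2 d1 (_ : t = ot x y z + ot x' y' (c *: z))); by rewrite -E.
- apply: (stationary_collinear (trilinear_swap13 ot3) (trilinear_swap13 phi3)
    s13 d2 d1 (_ : t = ot x' y' z' + ot x y (c *: z'))); by rewrite -E.
(* Each of the eight triples of basis vectors takes at least two entries from the same summand, so a
   first-order condition kills it. *)
have [yz xz xy] := phit _ _ _ _ _ _ erefl.
have [yz' xz' xy'] := phit _ _ _ _ _ _ tC.
have [a [b ->]] := spanx u; have [c [d ->]] := spany v.
have [e [f ->]] := spanz w.
rewrite !(trilinearD1, trilinearD2, trilinearD3) //.
rewrite !(trilinearZ1, trilinearZ2, trilinearZ3) //.
by rewrite !(yz, xz, xy, yz', xz', xy') !(scaler0, addr0).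
Qed.

Lemma rank_le2P (R : realType) (V1 V2 V3 : vectType R) (T : lmodType R)
    (ot : V1 -> V2 -> V3 -> T) (t : T) : is_tensor_product ot ->
  (rk ot t <= 2)%N <->
  exists x y z x' y' z', t = ot x y z + ot x' y' z'.
Proof.
move=> otP; have [[x [y [z tE]]] rk_min] := rkP t otP.
have ot0 := trilinear0 (proj1 otP); split=> [|[x1 [y1 [z1 [x2 [y2 [z2 E]]]]]]].
  (* Zero vectors pad a sum of fewer than two pure tensors. *)
  case: (rk ot t) x y z tE => [|[|[|//]]] x y z -> _.
  - by exists 0, 0, 0, 0, 0, 0; rewrite big_ord0 ot0 addr0.
  - by do 3!eexists; exists 0, 0, 0; rewrite ot0 addr0 big_ord1.
  - by do 6!eexists; rewrite big_ord_recl big_ord1.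
apply: rk_min; exists (fun i => if i == ord0 then x1 else x2),
  (fun i => if i == ord0 then y1 else y2), (fun i => if i == ord0 then z1 else z2).
by rewrite big_ord_recl big_ord1.
Qed.

(** * The Frobenius inner product and orthogonality *)

Section FrobeniusForm.
Variables (R : realType) (V1 V2 V3 : vectType R) (T : lmodType R).
Variable ot : V1 -> V2 -> V3 -> T.
Variables (n1 n2 n3 : nat).
Variables (e1 : n1.-tuple V1) (e2 : n2.-tuple V2) (e3 : n3.-tuple V3).

Definition frobenius_form (s t : T) : R :=
  \sum_p tensor_coords ot e1 e2 e3 s p * tensor_coords ot e1 e2 e3 t p.

Local Notation form := frobenius_form.

Lemma frobenius_formC s t : form s t = form t s.
Proof. by apply: eq_bigr => p _; rewrite mulrC. Qed.

Lemma frobenius_form_ge0 t : 0 <= form t t.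
Proof. by apply: sumr_ge0 => p _; rewrite -expr2 sqr_ge0. Qed.

Lemma frobenius_normE t : frobenius_norm ot e1 e2 e3 t = Num.sqrt (form t t).
Proof.
congr Num.sqrt; rewrite pair_bigA /=.
rewrite (pair_bigA _ (fun q k => `|tensor_coords ot e1 e2 e3 t (q.1, q.2, k)| ^+ 2)).
by apply: eq_bigr => -[[i j] k] _; rewrite /= real_normK ?num_real // expr2.
Qed.

Hypotheses (otP : is_tensor_product ot).
Hypotheses (e1P : basis_of fullv e1) (e2P : basis_of fullv e2).
Hypothesis e3P : basis_of fullv e3.

Lemma tensor_coords_comb a s t p :
  tensor_coords ot e1 e2 e3 (a *: s + t) p =
  a * tensor_coords ot e1 e2 e3 s p + tensor_coords ot e1 e2 e3 t p.
Proof.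
have E := tensor_coordsP e1P e2P e3P otP.
rewrite {1}[s]E {1}[t]E -tensor_of_coords_linear tensor_coords_uniq //.
by rewrite !ffunE.
Qed.

Lemma frobenius_form_linear s : linear (form s : T -> R^o).
Proof.
move=> a t u; rewrite /frobenius_form scaler_sumr -big_split /=.
by apply: eq_bigr => p _; rewrite tensor_coords_comb mulrDr mulrCA.
Qed.

Lemma frobenius_form_trilinear s :
  trilinear (fun u v w => form s (ot u v w) : R^o).
Proof.
by have [[l1 l2 l3] _] := otP; split=> x y a u v;
  rewrite ?l1 ?l2 ?l3 frobenius_form_linear.
Qed.

Lemma frobenius_form_eq0 t : form t t = 0 -> t = 0.
Proof.
move=> /psumr_eq0P t0; rewrite [t](tensor_coordsP e1P e2P e3P otP).
rewrite /tensor_of_coords big1 // => i _; rewrite big1 // => j _.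
rewrite big1 // => k _.
have /eqP := t0 (fun p _ => sqr_ge0 (tensor_coords ot e1 e2 e3 t p)) (i, j, k) isT.
by rewrite mulf_eq0 orbb => /eqP ->; rewrite scale0r.
Qed.

(** Pure tensors span, so [t] is orthogonal to itself. *)
Lemma frobenius_form_pure_eq0 t :
  (forall u v w, form t (ot u v w) = 0) -> t = 0.
Proof.
move=> t0; apply: frobenius_form_eq0.
have [n [x [y [z tE]]]] := sum_of_pure_exists e1P e2P e3P otP t.
rewrite {2}tE (big_morph (form t) (id1 := 0) (op1 := +%R)) ?big1 //.
  exact: linear_add (frobenius_form_linear t).
rewrite -[X in form t X](scale0r 0).
by rewrite (GRing.scalable_linear (frobenius_form_linear t)) [LHS]mul0r.
Qed.

Lemma frobenius_form_orthogonal s q :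
  (forall a, form s s <= form (s - a *: q) (s - a *: q)) -> form s q = 0.
Proof.
pose b := form s q; pose c := form q q.
have formB a : form (s - a *: q) (s - a *: q) = form s s - 2 * a * b + a ^+ 2 * c.
  have l r : form r (s - a *: q) = form r s - a * form r q.
    by rewrite addrC -scaleNr frobenius_form_linear addrC scaleNr.
  by rewrite l !(frobenius_formC (s - a *: q)) !l (frobenius_formC q s) -/b -/c; ring.
have c0 : 0 <= c := frobenius_form_ge0 q.
(* With [b = d * (c + 1)], minimality tested at [a = d] reads [0 <= - d ^+ 2 * (c + 2)], forcing
   [d = 0]. The [+ 1] avoids dividing by [c], which may be zero. *)
move=> /(_ (b / (c + 1))); rewrite formB -/b.
have : b = b / (c + 1) * (c + 1) by field; lra.
move: (b / (c + 1)) => d bE; rewrite bE => sle.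
have d0 : d ^+ 2 = 0 by nra.
by move/eqP: d0; rewrite sqrf_eq0 => /eqP ->; rewrite mul0r.
Qed.

End FrobeniusForm.

Theorem theorem12 (R : realType) (V1 V2 V3 : vectType R) (T : lmodType R)
    (ot : V1 -> V2 -> V3 -> T)
    (dimV1 : \dim {: V1} = 2%N) (dimV2 : \dim {: V2} = 2%N)
    (dimV3 : \dim {: V3} = 2%N)
    (otP : is_tensor_product ot)
    (e1 : 2.-tuple V1) (e2 : 2.-tuple V2) (e3 : 2.-tuple V3)
    (e1P : basis_of fullv e1) (e2P : basis_of fullv e2)
    (e3P : basis_of fullv e3)
    (tau : T) (rk_tau : rk ot tau = 3%N) :
  ~ exists upsilon : T,
      optimal_approx ot (frobenius_norm ot e1 e2 e3) 2 tau upsilon.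
Proof.
move=> [t [_ rk_t t_inf]]; have [ot3 _] := otP.
pose form := frobenius_form ot e1 e2 e3; pose s := tau - t.
have form_min t' : (rk ot t' <= 2)%N -> form s s <= form (tau - t') (tau - t').
  move=> rk_t'; rewrite -ler_sqrt ?frobenius_form_ge0 // -!frobenius_normE t_inf.
  apply: ge_inf; last by exists t'.
  (* The infimum is a lower bound only because the set of norms is bounded below, here by 0. *)
  by exists 0 => _ [r _ <-]; rewrite frobenius_normE sqrtr_ge0.
have orth q : (forall a, (rk ot (t + a *: q)%R <= 2)%N) -> form s q = 0.
  move=> rk_tq; apply: frobenius_form_orthogonal => // a.
  by rewrite /s -addrA -opprD; apply: form_min.
have [x [y [z [x' [y' [z' tE]]]]]] := (rank_le2P t otP).1 rk_t.
have st : stationary ot (fun u v w => form s (ot u v w) : R^o) t.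
  (* Varying one vector moves [t] along a line directed by a pure tensor while the rank stays at
     most two, so [orth] applies. *)
  move=> x1 y1 z1 x2 y2 z2 tE1.
  split=> u; apply: orth => a; apply/rank_le2P => //; rewrite tE1.
  - exists (x1 + a *: u), y1, z1, x2, y2, z2.
    by rewrite trilinearD1 // trilinearZ1 // addrAC.
  - exists x1, (y1 + a *: u), z1, x2, y2, z2.
    by rewrite trilinearD2 // trilinearZ2 // addrAC.
  - exists x1, y1, (z1 + a *: u), x2, y2, z2.
    by rewrite trilinearD3 // trilinearZ3 // addrAC.
rewrite tE in st.
have /frobenius_form_pure_eq0 : forall u v w, form s (ot u v w) = 0.
  apply: stationary_eq0 st => //; exact: frobenius_form_trilinear.
move=> /(_ otP e1P e2P e3P)/eqP; rewrite subr_eq0 => /eqP tau_t.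
by move: rk_t; rewrite -tau_t rk_tau.
Qed.
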